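(* Let $m\ge 1$, let $D$ and $\Omega$ be bounded open domains in $\mathbb{R}^{m}$ with piece-wise $C^{1}$-boundaries, and let $\varphi\in C^{1}(\bar{\Omega},\mathbb{R}^{m})$ be such that $\varphi:\Omega\rightarrow D$ is a $C^{1}$-diffeomorphism. If $f\in C(\bar{D})$ (a continuous real-valued function on $\bar D$), then $$\int_{D}f(y)\,\mathrm{d}y=\int_{\Omega}f(\varphi(x))\,\left\vert J_{\varphi}(x)\right\vert \,\mathrm{d}x,$$ where $J_{\varphi}(x)=\det\varphi^{\prime}(x)$ is the Jacobian determinant of $\varphi$ at $x\in\Omega$.
   Context: A domain is a nonempty connected open set. $\varphi\in C^{1}(\bar\Omega,\mathbb{R}^m)$ means that $\varphi$ is continuous on $\bar\Omega$, continuously differentiable in $\Omega$, and its first-order partial derivatives extend continuously to $\bar\Omega$. Piece-wise $C^1$-boundary. Let $U$ be a Jordan measurable bounded closed domain in $\mathbb{R}^{m-1}$ (the closure of a bounded domain) with interior $U^\circ$. A $C^1$-map $x:U\to\mathbb{R}^m$, $(u^1,\ldots,u^{m-1})\mapsto(x^1,\ldots,x^m)$, is called a $C^1$-parametrized surface if its restriction to $U^\circ$ is injective and the matrix $\left(\partial x^i/\partial u^j\right)$ has rank $m-1$ on $U$. The image $S=x(U)$ is called a hypersurface with parametrization $x$. A set $\Sigma\subset\mathbb{R}^m$ is a piece-wise $C^1$-hypersurface if $\Sigma=\bigcup_{i=1}^{\ell}S_i$ is a finite union of hypersurfaces $S_i=x_i(U_i)$ with $x_i(U_i^\circ)\cap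 x_j(U_j^\circ)=\emptyset$ for $i\ne j$. A bounded open domain has piece-wise $C^1$-boundary if its boundary is a piece-wise $C^1$-hypersurface. For $m=1$ a bounded open domain is just a bounded open interval, and the boundary condition is automatic. *)

(* Defs.v *)
From HB Require Import structures.
From mathcomp Require Import all_boot all_order all_algebra.
From mathcomp Require Import all_classical all_reals all_analysis.
Import Order.TTheory GRing.Theory Num.Theory.
Import numFieldNormedType.Exports.

Set Implicit Arguments.
Unset Strict Implicit.
Unset Printing Implicit Defensive.

Local Open Scope classical_set_scope.
Local Open Scope ring_scope.

(* MathComp-Analysis has Lebesgue measure on R only.  Row vectors get the
   sigma-algebra generated by the coordinates, as [n.-tuple T] does in the
   library; over the reals it is the Borel sigma-algebra. *)

Definition measure_rV_display : measure_display -> measure_display.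
Proof. exact. Qed.

Section measurable_rV.
Context {d} {T : measurableType d} (n : nat).

Let coord : 'I_n -> 'rV[T]_n -> T := fun i v => v ord0 i.

Let rV_set0 : g_sigma_preimage coord set0.
Proof. exact: sigma_algebra0. Qed.

Let rV_setC A : g_sigma_preimage coord A -> g_sigma_preimage coord (~` A).
Proof. exact: sigma_algebraC. Qed.

Let rV_bigcup (F : _^nat) : (forall i, g_sigma_preimage coord (F i)) ->
  g_sigma_preimage coord (\bigcup_i (F i)).
Proof. exact: sigma_algebra_bigcup. Qed.

HB.instance Definition _ := @isMeasurable.Build (measure_rV_display d)
  'rV[T]_n (g_sigma_preimage coord) rV_set0 rV_setC rV_bigcup.

Lemma measurable_coord (i : 'I_n) :
  measurable_fun [set: 'rV[T]_n] (fun v : 'rV[T]_n => v ord0 i).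
Proof.
move=> _ Y mY; rewrite setTI; apply: sub_sigma_algebra => /=.
rewrite -bigcup_seq/=; exists i => /=; first by rewrite mem_index_enum.
by exists Y => //; rewrite setTI.
Qed.

Lemma measurable_fun_rV d' (S : measurableType d') (f : S -> 'rV[T]_n) :
  (forall i, measurable_fun [set: S] (fun s => f s ord0 i)) ->
  measurable_fun [set: S] f.
Proof.
move=> mf _ Y mY; rewrite setTI.
have := mY (image_set_system setT f measurable).
rewrite /image_set_system/= setTI; apply; split.
  exact: (@sigma_algebra_image _ _ setT f _ (@sigma_algebra_measurable _ S)).
move=> A /=; rewrite -bigcup_seq/= => -[i _ [B mB <-]].
by rewrite !setTI; have := mf i measurableT B mB; rewrite setTI.
Qed.

End measurable_rV.

Section lebesgue_rV.
Context {R : realType}.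

Definition cons_rV n (p : R * 'rV[R]_n) : 'rV[R]_n.+1 := row_mx p.1%:M p.2.

Fixpoint lebesgue_rV n : set 'rV[R]_n -> \bar R :=
  if n is k.+1
  then pushforward (lebesgue_measure \x @lebesgue_rV k)%E (@cons_rV k)
  else \d_(0 : 'rV[R]_0).

Lemma measurable_cons_rV n : measurable_fun setT (@cons_rV n).
Proof.
apply: measurable_fun_rV => i.
case: (split_ordP (i : 'I_(1 + n))) => j ->.
- rewrite (_ : (fun _ => _) = fst) //.
  apply/funext => p; apply: etrans (row_mxEl _ _ _ _) _.
  by rewrite mxE (ord1 j) eqxx.
- rewrite (_ : (fun _ => _) = (fun v : 'rV[R]_n => v ord0 j) \o snd).
    exact: measurableT_comp (measurable_coord j) measurable_snd.
  by apply/funext => p; apply: etrans (row_mxEr _ _ _ _) _.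
Qed.

Definition uncons_rV n (v : 'rV[R]_n.+1) : R * 'rV[R]_n :=
  (v ord0 ord0, rsubmx (v : 'rV[R]_(1 + n))).

Lemma cons_rVK n : cancel (@cons_rV n) (@uncons_rV n).
Proof.
move=> [a v]; rewrite /uncons_rV /cons_rV; congr (_, _); last exact: row_mxKr.
transitivity (row_mx a%:M v ord0 (lshift n (ord0 : 'I_1))).
  by congr (fun_of_matrix _ _ _); exact: val_inj.
by rewrite row_mxEl mxE.
Qed.

Lemma measurable_uncons_rV n : measurable_fun setT (@uncons_rV n).
Proof.
apply: measurable_fun_pair => /=; first exact: measurable_coord.
apply: measurable_fun_rV => i.
rewrite (_ : (fun _ => _) =
  (fun v : 'rV[R]_n.+1 => v ord0 (rshift 1 i : 'I_n.+1))).
  exact: measurable_coord.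
by apply/funext => v; rewrite mxE.
Qed.

Section cons_measure.
Context n (m : {sigma_finite_measure set 'rV[R]_n -> \bar R}).

Definition cons_measure : set 'rV[R]_n.+1 -> \bar R :=
  pushforward (lebesgue_measure \x m)%E (@cons_rV n).

Let pushforward_cons : {measure set 'rV[R]_n.+1 -> \bar R}.
Proof.
unshelve refine (pushforward (lebesgue_measure \x m)%E (@cons_rV n) :
  {measure set 'rV[R]_n.+1 -> \bar R}).
exact: measurable_cons_rV.
Defined.

HB.instance Definition _ := Measure.copy cons_measure pushforward_cons.

Let sigma_finite_cons_measure : sigma_finite setT cons_measure.
Proof.
have /sigma_finiteP[F [FT ndF Foo]] := sigma_finiteT (@lebesgue_measure R).
have /sigma_finiteP[G [GT ndG Goo]] := sigma_finiteT m.
exists (fun k => @uncons_rV n @^-1` (F k `*` G k)).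
  apply/esym; rewrite -subTset => v _.
  have : setT (v ord0 ord0) by []; rewrite FT => -[i _ Fi].
  have : setT (uncons_rV v).2 by []; rewrite GT => -[j _ Gj].
  exists (maxn i j) => //; split => /=.
    by move: Fi; exact/subsetPset/ndF/leq_maxl.
  by move: Gj; exact/subsetPset/ndG/leq_maxr.
move=> k; have [mF Fk] := Foo k; have [mG Gk] := Goo k; split.
  rewrite -[X in measurable X]setTI; apply: measurable_uncons_rV => //.
  exact: measurableX.
rewrite /cons_measure /pushforward (_ : _ @^-1` _ = F k `*` G k).
  by rewrite product_measure1E// lte_mul_pinfty// ge0_fin_numE.
by apply/seteqP; split=> x; rewrite /preimage/mkset cons_rVK.
Qed.

HB.instance Definition _ := Measure_isSigmaFinite.Build _ _ _ cons_measure
  sigma_finite_cons_measure.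

End cons_measure.

Let lebesgue_rV_measure n :
  {m : {sigma_finite_measure set 'rV[R]_n -> \bar R} |
    m = @lebesgue_rV n :> (set _ -> _)}.
Proof.
elim: n => [|n [m mE]]; first by exists \d_(0 : 'rV[R]_0).
by exists (cons_measure m); rewrite /= -mE.
Qed.

Section instances.
Variable n : nat.
Let m := sval (lebesgue_rV_measure n).
Let mE : m = @lebesgue_rV n :> (set _ -> _) := svalP (lebesgue_rV_measure n).

Let lebesgue_rV0 : @lebesgue_rV n set0 = 0%E.
Proof. by rewrite -mE measure0. Qed.

Let lebesgue_rV_ge0 A : (0 <= @lebesgue_rV n A)%E.
Proof. by rewrite -mE measure_ge0. Qed.

Let lebesgue_rV_sigma_additive : semi_sigma_additive (@lebesgue_rV n).
Proof. by rewrite -mE; exact: measure_semi_sigma_additive. Qed.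

HB.instance Definition _ := isMeasure.Build _ _ _ (@lebesgue_rV n)
  lebesgue_rV0 lebesgue_rV_ge0 lebesgue_rV_sigma_additive.

Let sigma_finite_lebesgue_rV : sigma_finite setT (@lebesgue_rV n).
Proof. by rewrite -mE; exact: sigma_finiteT. Qed.

HB.instance Definition _ := Measure_isSigmaFinite.Build _ _ _ (@lebesgue_rV n)
  sigma_finite_lebesgue_rV.

End instances.

End lebesgue_rV.
Arguments lebesgue_rV {R} n _.

Lemma lebesgue_rV_box (R : realType) n (A : 'I_n -> set R) :
  (forall i, measurable (A i)) ->
  lebesgue_rV n [set v : 'rV[R]_n | forall i, A i (v ord0 i)] =
  (\prod_(i < n) lebesgue_measure (A i))%E.
Proof.
elim: n A => [|n ih] A mA.
  rewrite big_ord0 /= diracE mem_set//; by case.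
rewrite big_ord_recl -ih; last by move=> i; exact: mA.
rewrite [LHS]/= /pushforward -product_measure1E//; [|exact: mA|]; last first.
  rewrite (_ : mkset _ = \bigcap_(i : 'I_n)
      ((fun v : 'rV[R]_n => v ord0 i) @^-1` A (lift ord0 i))).
    apply: fin_bigcap_measurable => // i _.
    by rewrite -[X in measurable X]setTI; apply: measurable_coord.
  by apply/seteqP; split=> v /= Av i *; exact: Av.
have coordL (v : R * 'rV[R]_n) : cons_rV v ord0 ord0 = v.1.
  by have /(congr1 fst) := cons_rVK v.
have coordR (v : R * 'rV[R]_n) i : cons_rV v ord0 (lift ord0 i) = v.2 ord0 i.
  transitivity (row_mx v.1%:M v.2 ord0 (rshift 1 i)); last exact: row_mxEr.
  by congr (fun_of_matrix _ _ _); exact: val_inj.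
apply: congr1; apply/seteqP; split=> v /=.
  move=> Av; split; first by rewrite -coordL.
  by move=> i; rewrite -coordR.
move=> [A0 Av] i; case: (unliftP ord0 i) => [j|] ->; last by rewrite coordL.
by rewrite coordR.
Qed.

Section euclidean.
Context {R : realType}.

Definition bounded_domain n (A : set 'rV[R]_n) :=
  [/\ A !=set0, open A, connected A & bounded_set A].

Definition boundary n (A : set 'rV[R]_n) := closure A `\` A°.

(* ['J g x] acts on row vectors on the right, so it is the transpose of the
   usual matrix of partial derivatives; rank and determinant are the same. *)
Definition C1_on n p (A : set 'rV[R]_n) (g : 'rV[R]_n -> 'rV[R]_p) :=
  forall x, A x -> differentiable g x /\ {for x, continuous (jacobian g)}.

(* [g] is of class C^1 on the closure of the open set [A], and [dg] is the
   continuous extension to that closure of its matrix of first-order partial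
   derivatives. *)
Definition C1_closure_with n p (A : set 'rV[R]_n) (g : 'rV[R]_n -> 'rV[R]_p)
    (dg : 'rV[R]_n -> 'M[R]_(n, p)) :=
  [/\ {within closure A, continuous g}, C1_on A g,
      {within closure A, continuous dg} & forall x, A x -> dg x = 'J g x].

Definition C1_closure n p (A : set 'rV[R]_n) (g : 'rV[R]_n -> 'rV[R]_p) :=
  exists dg, C1_closure_with A g dg.

Definition C1_diffeomorphism n (A B : set 'rV[R]_n)
    (g : 'rV[R]_n -> 'rV[R]_n) :=
  [/\ set_bij A B g, C1_on A g &
      exists h, (forall x, A x -> h (g x) = x) /\ C1_on B h].

Definition box n (a b : 'rV[R]_n) :=
  [set x : 'rV[R]_n | forall i, a ord0 i <= x ord0 i <= b ord0 i].

Definition content_zero n (A : set 'rV[R]_n) :=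
  forall e : R, 0 < e -> exists (k : nat) (a b : 'I_k -> 'rV[R]_n),
    [/\ forall j i, a j ord0 i <= b j ord0 i,
        A `<=` \bigcup_j box (a j) (b j) &
        \sum_j \prod_i (b j ord0 i - a j ord0 i) < e].

Definition Jordan_measurable n (A : set 'rV[R]_n) :=
  bounded_set A /\ content_zero (boundary A).

Definition C1_parametrized_surface n p (U : set 'rV[R]_n)
    (x : 'rV[R]_n -> 'rV[R]_p) :=
  [/\ exists2 V, bounded_domain V & U = closure V,
      Jordan_measurable U,
      set_inj U° x &
      (* [closure U° = U] since [U] is the closure of an open set. *)
      exists2 dx, C1_closure_with U° x dx & forall u, U u -> \rank (dx u) = n].

Definition piecewise_C1_hypersurface m (S : set 'rV[R]_m) :=
  exists (l : nat) (U : 'I_l -> set 'rV[R]_m.-1)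
         (x : 'I_l -> 'rV[R]_m.-1 -> 'rV[R]_m),
  [/\ forall i, C1_parametrized_surface (U i) (x i),
      S = \bigcup_i (x i @` U i) &
      forall i j, i != j -> (x i @` (U i)°) `&` (x j @` (U j)°) = set0].

(* For [m = 1] a bounded domain is an open interval, and nothing is required. *)
Definition piecewise_C1_boundary m (A : set 'rV[R]_m) :=
  (1 < m)%N -> piecewise_C1_hypersurface (boundary A).

End euclidean.

(* Main.v *)
Require Import Defs.
From HB Require Import structures.
From mathcomp Require Import all_boot all_order all_fingroup all_algebra.
From mathcomp Require Import all_classical all_reals all_analysis.
From mathcomp Require Import measurable_realfun ring lra zify.
Import Order.TTheory GRing.Theory Num.Theory.
Import numFieldNormedType.Exports.

Local Open Scope classical_set_scope.
Local Open Scope ring_scope.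

(* The Borel measures [A |-> mu (phi A)] and [A |-> \int_A |J_phi|] are compared
   locally. Near [x], with [T := phi'(x)], the map [T^-1 o phi] and its inverse
   are Lipschitz with constant [1/s] for any given [s < 1]. A map that is
   [L]-Lipschitz for the sup norm multiplies the measure of a Borel set by at
   most [L^m], because it maps a cube of side [d] into a cube of side [L d] and
   Borel sets are covered efficiently by dyadic cubes; and [T] multiplies
   measures by [|det T|]. So both measures agree up to a power of [s] on small
   cubes, hence on every Borel set after cutting it along countably many dyadic
   cubes, and [s] tends to [1]. *)

Set Implicit Arguments.
Unset Strict Implicit.

(** * Dyadic cubes *)

(** Approximation from outside by unions of cubes replaces it. The cubes are half-open: those of one
    level partition the space exactly, and no faces have to be shown negligible. Images of Borel
    sets are never formed. The image of [A] under [phi] is written as the part of [D] that the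
    inverse [h] sends into [A], and the Lipschitz estimate is likewise stated through the inverse
    map, so that every set is visibly measurable. The total loss is [s ^+ n.+1]: [n] factors from
    the Lipschitz constant in dimension [n], and one from the oscillation of the Jacobian
    determinant. *)

Lemma measure_le_fibers d (T : measurableType d) (R : realType)
    (m1 m2 : {measure set T -> \bar R}) (I : countType) (g : T -> I)
    (A : set T) :
  measurable A -> (forall z, measurable (g @^-1` [set z])) ->
  (forall z, m1 (A `&` g @^-1` [set z]) <= m2 (A `&` g @^-1` [set z]))%E ->
  (m1 A <= m2 A)%E.
Proof.
move=> mA mg m12.
(* [pickle] numbers the fibers by naturals; a number that codes no index gives the empty piece. *)
pose F i := A `&` g @^-1` [set z | pickle z = i].
have FE i : F i = set0 \/ exists z, F i = A `&` g @^-1` [set z].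
  case: (pselect (exists z : I, pickle z = i)) => [[z <-]|nz].
    right; exists z; congr (_ `&` _); apply/seteqP; split => x /=.
      by move/(pcan_inj pickleK).
    by move=> ->.
  by left; apply/seteqP; split => // x [_ /= gx]; apply: nz; exists (g x).
have mF i : measurable (F i).
  by have [->|[z ->]] := FE i; [exact: measurable0|exact: measurableI].
have AE : A = \bigcup_i F i.
  apply/seteqP; split=> [x Ax|x [i _ []]//].
  by exists (pickle (g x)).
have tF : trivIset setT F.
  by move=> i j _ _ [x [[_ /= <-] [_ /= <-]]].
rewrite AE !measure_bigcup//; apply: lee_nneseries => [i _ _|i _].
  exact: measure_ge0.
by have [->|[z ->]] := FE i; [rewrite !measure0|exact: m12].
Qed.

Section dyadic.
Context {R : realType} {n : nat}.
Implicit Types (k : nat) (x y : 'rV[R]_n).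

(** Integer label of the half-open cube of side [2^-k] that contains [x]. The cubes are the fibers,
    so at each level they form a countable partition. *)
Definition dyadic k x : 'rV[int]_n := \row_i Num.floor (2 ^+ k * x ord0 i).

Lemma dyadic_eqP k x z : dyadic k x = z <->
  forall i, (z ord0 i)%:~R / 2 ^+ k <= x ord0 i < (z ord0 i + 1)%:~R / 2 ^+ k.
Proof.
have k0 : 0 < (2 : R) ^+ k by rewrite exprn_gt0.
split=> [<- i|xz].
  by rewrite mxE ler_pdivrMr// ltr_pdivlMr// mulrC floor_itv.
apply/rowP => i; rewrite mxE; apply: floor_def.
by rewrite mulrC -ler_pdivrMr// -ltr_pdivlMr.
Qed.

Lemma dyadic_fiberE k z : dyadic k @^-1` [set z] =
  [set x : 'rV[R]_n | forall i, `[(z ord0 i)%:~R / 2 ^+ k,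
    (z ord0 i + 1)%:~R / 2 ^+ k[%classic (x ord0 i)].
Proof.
apply/seteqP; split => x /= => [/dyadic_eqP xz i|xz]; first by rewrite in_itv/=.
by apply/dyadic_eqP => i; have := xz i; rewrite in_itv.
Qed.

Lemma measurable_box (B : 'I_n -> set R) : (forall i, measurable (B i)) ->
  measurable [set x : 'rV[R]_n | forall i, B i (x ord0 i)].
Proof.
move=> mB.
rewrite (_ : mkset _ = \bigcap_(i : 'I_n) ((fun x : 'rV[R]_n => x ord0 i) @^-1` B i)).
  apply: fin_bigcap_measurable => // i _.
  by rewrite -[X in measurable X]setTI; apply: measurable_coord.
by apply/seteqP; split=> [x xB i _|x xB i]; exact: xB.
Qed.

Lemma measurable_dyadic_fiber k z : measurable (dyadic k @^-1` [set z]).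
Proof.
rewrite dyadic_fiberE.
apply: (@measurable_box (fun i =>
  `[(z ord0 i)%:~R / 2 ^+ k, (z ord0 i + 1)%:~R / 2 ^+ k[%classic)) => i.
exact: measurable_itv.
Qed.

Lemma measurable_dyadic k (Z : set 'rV[int]_n) : measurable (dyadic k @^-1` Z).
Proof.
rewrite (_ : _ @^-1` _ =
    \bigcup_(z : 'rV[int]_n) (if `[< Z z >] then dyadic k @^-1` [set z] else set0)).
  apply: countable_bigcupT_measurable => // z.
  by case: ifPn => _; [exact: measurable_dyadic_fiber|exact: measurable0].
apply/seteqP; split=> [x Zx|x [z _]].
  by exists (dyadic k x) => //; case: asboolP.
by case: asboolP => // Zz /= ->.
Qed.

(** Cubes are nested because [Num.floor (2 * a)] determines [Num.floor a]. *)
Lemma dyadicW k l x y : (k <= l)%N ->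
  dyadic l x = dyadic l y -> dyadic k x = dyadic k y.
Proof.
move=> /subnK <-; elim: (l - k)%N => // {}l ih; rewrite addSn => xy; apply: ih.
move: (l + k)%N xy => {l}k /rowP xy; apply/rowP => i; rewrite !mxE.
have h (a b : R) : Num.floor (2 * a) = Num.floor (2 * b) -> Num.floor a = Num.floor b.
  move=> ab; apply: floor_def.
  have /andP[b0 b1] := floor_itv b.
  apply/andP; split.
    suff : (2 * Num.floor b)%:~R <= 2 * a by rewrite intrM ler_pM2l.
    by rewrite -floor_ge_int ab floor_ge_int intrM ler_pM2l.
  suff : 2 * a < (2 * (Num.floor b + 1))%:~R by rewrite intrM ltr_pM2l.
  by rewrite -floor_lt_int ab floor_lt_int intrM ltr_pM2l.
by have := xy i; rewrite !mxE exprS -!mulrA => /h.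
Qed.

Lemma dyadic_dist k x y i : dyadic k x = dyadic k y ->
  `|x ord0 i - y ord0 i| <= 2^-1 ^+ k.
Proof.
move=> /dyadic_eqP/(_ i); have /dyadic_eqP/(_ i) := erefl (dyadic k y).
rewrite intrD mulrDl mul1r exprVn ler_norml => /andP[y0 y1] /andP[x0 x1].
by apply/andP; split; lra.
Qed.

(** Openness for the topology generated by the cubes. It is finer than the usual one: half-open
    cubes are open in it, and so are their complements. Every such set is still a countable union of
    cubes, hence Borel. *)
Definition dyadic_open (G : set 'rV[R]_n) :=
  forall x, G x -> exists k, dyadic k @^-1` [set dyadic k x] `<=` G.

Lemma nbhs_dyadic x (G : set 'rV[R]_n) : nbhs x G ->
  exists k, dyadic k @^-1` [set dyadic k x] `<=` G.
Proof.
move=> /nbhs_ballP[e /= e0 eG].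
have [k ke] : exists k, (2^-1 : R) ^+ k < e.
  have := @cvg_expr R 2^-1; rewrite ger0_norm// invf_lt1// ltr1n => /(_ isT).
  move=> /cvgr0_norm_lt /(_ e e0) [k _ /(_ k (leqnn k))] /=.
  by move=> ke; exists k; rewrite (le_lt_trans _ ke)// ler_norm.
exists k => y /= yx; apply: eG; split => // i j.
rewrite (ord1 i) /ball/= (le_lt_trans _ ke)//.
exact: dyadic_dist.
Qed.

Lemma open_dyadic (G : set 'rV[R]_n) : open G -> dyadic_open G.
Proof. by rewrite openE => oG x /oG /nbhs_dyadic. Qed.

(** The union of the cubes of level [k] inside [G]. It grows with [k], exhausts a dyadic open [G],
    and has a dyadic open complement, so it serves as an inner closed approximation. *)
Definition dyadic_interior k (G : set 'rV[R]_n) :=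
  dyadic k @^-1` [set z | dyadic k @^-1` [set z] `<=` G].

Lemma sub_dyadic_interior k G : dyadic_interior k G `<=` G.
Proof. by move=> x; apply. Qed.

Lemma dyadic_openE G : dyadic_open G -> G = \bigcup_k dyadic_interior k G.
Proof.
move=> oG; apply/seteqP; split=> [x /oG[k kG]|x [k _ /sub_dyadic_interior//]].
by exists k.
Qed.

Lemma dyadic_interior_nd G :
  {homo dyadic_interior ^~ G : k l / (k <= l)%N >-> (k <= l)%O}.
Proof.
move=> k l kl; apply/subsetPset => x xG y /= yx; apply: xG => /=.
exact: dyadicW yx.
Qed.

Lemma measurable_dyadic_open G : dyadic_open G -> measurable G.
Proof.
move=> /dyadic_openE ->; apply: bigcupT_measurable => k.
exact: measurable_dyadic.
Qed.

Lemma open_measurable_rV (G : set 'rV[R]_n) : open G -> measurable G.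
Proof. by move=> /open_dyadic /measurable_dyadic_open. Qed.

Lemma dyadic_interiorC_open k G : dyadic_open (~` dyadic_interior k G).
Proof.
by move=> x xG; exists k => y /= yx; rewrite /dyadic_interior/= yx.
Qed.

Lemma dyadic_open_bigcup (F : nat -> set 'rV[R]_n) :
  (forall i, dyadic_open (F i)) -> dyadic_open (\bigcup_i F i).
Proof.
move=> oF x [i _ /oF[k kF]]; exists k; apply: subset_trans kF _.
exact: bigcup_sup.
Qed.

Lemma dyadic_openI (A B : set 'rV[R]_n) :
  dyadic_open A -> dyadic_open B -> dyadic_open (A `&` B).
Proof.
move=> oA oB x [/oA[k kA] /oB[l lB]]; exists (maxn k l) => y /= yx; split.
  by apply: kA; apply: dyadicW yx; exact: leq_maxl.
by apply: lB; apply: dyadicW yx; exact: leq_maxr.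
Qed.

End dyadic.

(** * Comparison of measures on dyadic cubes *)

Section dyadic_regularity.
Context {R : realType} {n : nat}.
Variable m : {finite_measure set 'rV[R]_n -> \bar R}.

(** The inner closed set is given by its complement [F]. This makes the condition symmetric: passing
    to the complement of [A] just exchanges [G] and [F]. *)
Definition dyadic_regular (A : set 'rV[R]_n) := forall e : R, 0 < e ->
  exists G F : set 'rV[R]_n, [/\ dyadic_open G, dyadic_open F,
    ~` F `<=` A, A `<=` G & (m (G `&` F) <= e%:E)%E].

(** The sets [G] minus its level [k] interior decrease to the empty set, so their measures tend to
    0, the measure being finite. *)
Lemma dyadic_open_regular G : dyadic_open G -> dyadic_regular G.
Proof.
move=> dG e e0.
pose E k := G `\` dyadic_interior k G.
have mE k : measurable (E k).
  by apply: measurableD; [exact: measurable_dyadic_open|exact: measurable_dyadic].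
have capE : \bigcap_k E k = set0.
  rewrite -subset0 => x xE; have [Gx _] := xE 0%N Logic.I.
  by move: Gx; rewrite {1}(dyadic_openE dG) => -[k _ ?]; have [] := xE k Logic.I.
have cE : m (E k) @[k --> \oo] --> 0%E.
  rewrite -(measure0 m) -capE; apply: nonincreasing_cvg_mu => //.
  - by rewrite ltey_eq fin_num_measure.
  - by rewrite capE.
  - move=> k l kl; apply/subsetPset; apply: setDS; apply/subsetPset.
    exact: dyadic_interior_nd.
have := cE (fun x => x < e%:E)%E; case.
  by apply: open_nbhs_nbhs; split; [exact: open_ereal_lt_ereal|rewrite /= lte_fin].
move=> k _ /(_ k (leqnn k))/= mk.
exists G, (~` dyadic_interior k G); split => //.
- exact: dyadic_interiorC_open.
- by rewrite setCK; exact: sub_dyadic_interior.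
- exact: ltW.
Qed.

Lemma dyadic_regularC A : dyadic_regular A -> dyadic_regular (~` A).
Proof.
move=> rA e /rA[G [F [dG dF FA AG GF]]]; exists F, G; split => //.
- exact: subsetC.
- by rewrite -(setCK F); exact: subsetC.
- by rewrite setIC.
Qed.

Lemma dyadic_regular_bigcup (A : nat -> set 'rV[R]_n) :
  (forall i, dyadic_regular (A i)) -> dyadic_regular (\bigcup_i A i).
Proof.
move=> rA e e0; have e20 : 0 < e / 2 by rewrite divr_gt0.
have /choice[GF GFP] : forall i, exists GF : set 'rV[R]_n * set 'rV[R]_n,
    [/\ dyadic_open GF.1, dyadic_open GF.2, ~` GF.2 `<=` A i, A i `<=` GF.1 &
      (m (GF.1 `&` GF.2) <= (e / 2 / (2 ^ i.+1)%:R)%:E)%E].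
  move=> i; have [|G [F GF]] := rA i (e / 2 / (2 ^ i.+1)%:R).
    by rewrite divr_gt0// ltr0n expn_gt0.
  by exists (G, F).
pose G := \bigcup_i (GF i).1.
(* An infinite union of closed sets need not be closed, so only the first [k] inner sets are united.
   Continuity from above then lets a finite [k] suffice, which is why the errors sum to [e / 2] and
   not to [e]. *)
pose F k := \bigcap_(i in `I_k) (GF i).2.
have dG : dyadic_open G.
  by apply: dyadic_open_bigcup => i; have [] := GFP i.
have mGF i : measurable (GF i).1 /\ measurable (GF i).2.
  by have [p1 p2 _ _ _] := GFP i; split; exact: measurable_dyadic_open.
have mF k : measurable (F k).
  by apply: fin_bigcap_measurable => // i _; have [] := mGF i.
have dFk k : dyadic_open (F k).
  rewrite /F; elim: k => [|k ih].
    by rewrite II0 bigcap_set0 => x _; exists 0%N.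
  rewrite IIS bigcap_setU bigcap_set1; apply: dyadic_openI => //.
  by have [] := GFP k.
have capF : \bigcap_k F k = \bigcap_i (GF i).2.
  apply/seteqP; split => [x xF i _|x xF k _ i _]; last exact: xF.
  by apply: (xF i.+1) => //=.
have mcapF : measurable (\bigcap_k F k).
  by rewrite capF; apply: bigcapT_measurable => i; have [] := mGF i.
have cGF : m (G `&` F k) @[k --> \oo] --> m (G `&` \bigcap_k F k).
  rewrite -bigcapIr; last by exists 0%N.
  apply: nonincreasing_cvg_mu => //.
  - rewrite ltey_eq fin_num_measure//; apply: measurableI => //.
    exact: measurable_dyadic_open.
  - by move=> k; apply: measurableI => //; exact: measurable_dyadic_open.
  - rewrite bigcapIr; last by exists 0%N.
    apply: measurableI => //; exact: measurable_dyadic_open.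
  - move=> k l kl; apply/subsetPset; apply: setIS => x xF i /= ik.
    by apply: xF => /=; exact: leq_trans kl.
have limGF_le : (m (G `&` \bigcap_k F k) <= (e / 2)%:E)%E.
  apply: (@le_trans _ _ (\sum_(0 <= i <oo) m ((GF i).1 `&` (GF i).2))%E).
    apply: measure_sigma_subadditive.
    - by move=> i; have [] := mGF i; exact: measurableI.
    - by apply: measurableI => //; exact: measurable_dyadic_open.
    - by rewrite capF => x [[i _ Gx] Fx]; exists i => //; split => //; exact: Fx.
  apply: le_trans (_ : (\sum_(0 <= i <oo) (0 + (e / 2 / (2 ^ i.+1)%:R)%:E))%E <= _)%E.
    apply: lee_nneseries => [i _ _|i _]; first exact: measure_ge0.
    by rewrite add0e; have [] := GFP i.
  apply: le_trans (epsilon_trick xpredT _ (ltW e20)) _ => //.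
  by rewrite eseries0// add0e.
have limGF_lt : (m (G `&` \bigcap_k F k) < e%:E)%E.
  by rewrite (le_lt_trans limGF_le)// lte_fin ltr_pdivrMr// ltr_pMr// ltr1n.
have := cGF (fun x => x < e%:E)%E; case.
  by apply: open_nbhs_nbhs; split; [exact: open_ereal_lt_ereal|].
move=> k _ /(_ k (leqnn k))/= mk.
exists G, (F k); split => //; last exact: ltW.
- move=> x /existsNP[i /not_implyP[/= _ ?]]; exists i => //.
  by have [_ _ + _ _] := GFP i; apply.
- apply: subset_bigcup => i _; by have [] := GFP i.
Qed.

(** Regular sets form a sigma-algebra. Two generation steps are unwound: from row vectors to
    preimages under one coordinate, then from Borel sets of the line to open intervals, whose
    preimages are open. *)
Lemma measurable_dyadic_regular A : measurable A -> dyadic_regular A.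
Proof.
move=> mA; apply: (smallest_sub _ _ mA) => [|B].
  split; first by apply: dyadic_open_regular => ? [].
    by move=> B; rewrite setTD; exact: dyadic_regularC.
  exact: dyadic_regular_bigcup.
rewrite -bigcup_seq/= => -[i _ [C mC <-]]; rewrite setTI.
have mC' : (RGenOpens.G (R := R)).-sigma.-measurable C.
  by rewrite -RGenOpens.measurableE.
pose P (C : set R) := dyadic_regular ((fun v : 'rV[R]_n => v ord0 i) @^-1` C).
apply: (smallest_sub (X := P) _ _ mC') => [|D [x [y ->]]].
  split; first by apply: dyadic_open_regular => ? [].
    by move=> D; rewrite /P setTD preimage_setC; exact: dyadic_regularC.
  by move=> F rF; rewrite /P preimage_bigcup; exact: dyadic_regular_bigcup.
apply/dyadic_open_regular/open_dyadic.
apply: open_comp => [v _|]; last exact: interval_open.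
exact: coord_continuous.
Qed.

End dyadic_regularity.

Section dyadic_comparison.
Context {R : realType} {n : nat}.
Variables m1 m2 : {measure set 'rV[R]_n -> \bar R}.

(** Each dyadic interior of [G] is a countable disjoint union of cubes on which the bound is
    assumed; continuity from below reaches [G]. *)
Lemma dyadic_open_measure_le (G : set 'rV[R]_n) :
  (forall k z, dyadic k @^-1` [set z] `<=` G ->
    m1 (dyadic k @^-1` [set z]) <= m2 (dyadic k @^-1` [set z]))%E ->
  dyadic_open G -> (m1 G <= m2 G)%E.
Proof.
move=> m12 dG.
have mi k : measurable (dyadic_interior k G) by exact: measurable_dyadic.
have mG := measurable_dyadic_open dG.
have cG : m1 (dyadic_interior k G) @[k --> \oo] --> m1 G.
  rewrite [in m1 G](dyadic_openE dG); apply: nondecreasing_cvg_mu => //.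
    by rewrite -dyadic_openE.
  exact: dyadic_interior_nd.
rewrite -(cvg_lim _ cG)//; apply: lime_le; first by apply/cvg_ex; exists (m1 G).
apply: nearW => k.
apply: (@le_trans _ _ (m2 (dyadic_interior k G))); last first.
  by apply: le_measure; rewrite ?inE//; exact: sub_dyadic_interior.
apply: (measure_le_fibers (g := dyadic k)) => // [z|z].
  exact: measurable_dyadic_fiber.
have [zG|zG] := pselect (dyadic k @^-1` [set z] `<=` G).
  rewrite (_ : _ `&` _ = dyadic k @^-1` [set z]); first exact: m12.
  by apply: setIidr => x /= xz; rewrite /dyadic_interior/= xz.
rewrite (_ : _ `&` _ = set0) ?measure0//.
by rewrite -subset0 => x [/= + xz]; rewrite /dyadic_interior/= xz.
Qed.

Lemma dyadic_measure_le :
  (forall k z, m1 (dyadic k @^-1` [set z]) <= m2 (dyadic k @^-1` [set z]))%E ->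
  (forall z, m2 (dyadic 0 @^-1` [set z]) < +oo)%E ->
  forall A, measurable A -> (m1 A <= m2 A)%E.
Proof.
move=> m12 m2oo A mA.
apply: (measure_le_fibers (g := @dyadic R n 0)) => // z.
  exact: measurable_dyadic_fiber.
set C := _ @^-1` _; have mC : measurable C by exact: measurable_dyadic_fiber.
have mAC : measurable (A `&` C) by exact: measurableI.
(* Regularity is available for finite measures, hence the restriction of [m2] to a unit cube [C]. It
   controls only the part of [G] inside [C], so [G] is cut by [C], which keeps it dyadic open. *)
pose mr : {finite_measure set 'rV[R]_n -> \bar R} := mfrestr mC (m2oo z).
apply/lee_addgt0Pr => e e0.
have [G [F [dG dF FA AG GF]]] := measurable_dyadic_regular mr mAC e0.
have mG := measurable_dyadic_open dG.
have mF := measurable_dyadic_open dF.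
have oGC : dyadic_open (G `&` C).
  by apply: dyadic_openI => // x Cx; exists 0%N => y /= yx; rewrite /C/= yx.
apply: (@le_trans _ _ (m1 (G `&` C))).
  apply: le_measure; rewrite ?inE//; first exact: measurableI.
  by move=> x ACx; split; [exact: AG|case: ACx].
apply: (@le_trans _ _ (m2 (G `&` C))).
  by apply: dyadic_open_measure_le.
apply: (@le_trans _ _ (m2 ((A `&` C) `|` (G `&` F `&` C)))%E).
  apply: le_measure; rewrite ?inE.
  - exact: measurableI.
  - by apply: measurableU => //; apply: measurableI => //; exact: measurableI.
  move=> x [Gx Cx]; have [Fx|/FA] := pselect (F x); [right|left]; by [].
rewrite (le_trans (measureU2 _ _ _))//.
  by apply: measurableI => //; exact: measurableI.
by apply: leeD.
Qed.

Lemma local_measure_le (U A : set 'rV[R]_n) :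
  (forall x, U x -> exists k, forall B, measurable B ->
     B `<=` dyadic k @^-1` [set dyadic k x] -> (m1 B <= m2 B)%E) ->
  measurable A -> A `<=` U -> (m1 A <= m2 A)%E.
Proof.
move=> loc mA AU.
(* The admissible level depends on the point. Quantifying over all Borel subsets of the cube makes
   goodness pass to smaller cubes, so the sets [E k] increase to [A]. *)
pose good k := [set z : 'rV[int]_n | forall B, measurable B ->
  B `<=` @dyadic R n k @^-1` [set z] -> (m1 B <= m2 B)%E].
pose E k := A `&` dyadic k @^-1` good k.
have mE k : measurable (E k).
  by apply: measurableI => //; exact: measurable_dyadic.
have AE : A = \bigcup_k E k.
  apply/seteqP; split=> [x Ax|x [k _ []]//].
  by have [k kx] := loc x (AU _ Ax); exists k.
have cE : m1 (E k) @[k --> \oo] --> m1 A.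
  rewrite [in m1 A]AE; apply: nondecreasing_cvg_mu => //.
    by rewrite -AE.
  move=> k l kl; apply/subsetPset; apply: setIS => x /= gx B mB Bl.
  by apply: gx => // y /Bl/=; exact: dyadicW.
rewrite -(cvg_lim _ cE)//; apply: lime_le; first by apply/cvg_ex; exists (m1 A).
apply: nearW => k.
apply: (@le_trans _ _ (m2 (E k))); last first.
  by apply: le_measure; rewrite ?inE// => x [].
apply: (measure_le_fibers (g := dyadic k)) => // [z|z].
  exact: measurable_dyadic_fiber.
have [zG|zG] := pselect (good k z).
  apply: zG; last exact: subIsetr.
  by apply: measurableI => //; exact: measurable_dyadic_fiber.
rewrite (_ : _ `&` _ = set0) ?measure0//.
by rewrite -subset0 => x [[_ /=] + xz]; rewrite xz.
Qed.

End dyadic_comparison.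

(** * Linear maps *)

Lemma exists_pushforward d1 d2 (T1 : measurableType d1) (T2 : measurableType d2)
    (R : realType) (m : {measure set T1 -> \bar R}) (f : T1 -> T2) :
  measurable_fun setT f ->
  exists m' : {measure set T2 -> \bar R},
    m' = pushforward m f :> (set T2 -> \bar R).
Proof.
move=> mf; unshelve eexists (pushforward m f : {measure set T2 -> \bar R}) => //.
Qed.

(** By uniqueness of Lebesgue measure it is enough to compare lengths of intervals []u, v]]. *)
Lemma lebesgue_measure_affine (R : realType) (l b : R) (B : set R) :
  l != 0 -> measurable B ->
  (lebesgue_measure ((fun a => a * l + b)%R @^-1` B) * `|l|%:E =
   lebesgue_measure B)%E.
Proof.
move=> l0 mB; pose f (a : R) : measurableTypeR R := (a * l + b)%R.
have mf : measurable_fun [set: measurableTypeR R] f.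
  by apply: measurable_funD => //; exact: mulrr_measurable.
have [m mE] := exists_pushforward lebesgue_measure mf.
pose m' : {measure set (measurableTypeR R) -> \bar R} := mscale (NngNum (normr_ge0 l)) m.
transitivity (m' B); first by rewrite /m'/= /mscale/= mE muleC.
apply/esym/lebesgue_measure_unique => // _ [[u v] _ <-].
rewrite /m'/= /mscale/= mE /pushforward lebesgue_measure_itv/=.
have [lp|ln] : (0 < l \/ l < 0)%R.
  by move: l0; rewrite neq_lt => /orP[]; [right|left].
- rewrite (_ : f @^-1` _ = `](u - b) / l, (v - b) / l]%classic); last first.
    apply/seteqP; split=> x /=; rewrite /f !in_itv/=;
    by rewrite ltr_pdivrMr// ler_pdivlMr// ltrBlDr lerBrDr.
  rewrite lebesgue_measure_itv/= !lte_fin ltr_pM2r ?invr_gt0// ltrD2r gtr0_norm//.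
  case: ifP => _; last by rewrite mule0.
  by rewrite -!EFinB -EFinM; congr EFin; field.
(* A negative slope exchanges the endpoints, and with them the side on which the interval is
   closed. *)
- rewrite (_ : f @^-1` _ = `[(v - b) / l, (u - b) / l[%classic); last first.
    apply/seteqP; split=> x /=; rewrite /f !in_itv/=;
    by rewrite ler_ndivrMr// ltr_ndivlMr// ltrBlDr lerBrDr andbC.
  rewrite lebesgue_measure_itv/= !lte_fin ltr_nM2r ?invr_lt0// ltrD2r ltr0_norm//.
  case: ifP => _; last by rewrite mule0.
  by rewrite -!EFinB -EFinM; congr EFin; field.
Qed.

Section linear_change.
Context {R : realType}.

Lemma measurable_mulmxr n (T : 'M[R]_n) :
  measurable_fun [set: 'rV[R]_n] (fun v : 'rV[R]_n => v *m T).
Proof.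
apply: measurable_fun_rV => i.
rewrite (_ : (fun _ => _) = fun v : 'rV[R]_n => \sum_j v ord0 j * T j i).
  apply: measurable_sum => j; apply: measurable_funM => //.
  exact: measurable_coord.
by apply/funext => v; rewrite mxE.
Qed.

Definition lebesgue_scaling n (T : 'M[R]_n) := forall A, measurable A ->
  (lebesgue_rV n ((fun v : 'rV[R]_n => v *m T) @^-1` A) * `|\det T|%:E =
   lebesgue_rV n A)%E.

Lemma lebesgue_scalingM n (S T : 'M[R]_n) :
  lebesgue_scaling S -> lebesgue_scaling T -> lebesgue_scaling (S *m T).
Proof.
move=> scS scT A mA; rewrite -[RHS]scT// -[in RHS]scS; last first.
  by rewrite -[X in measurable X]setTI; apply: measurable_mulmxr.
rewrite det_mulmx normrM EFinM -muleA; congr (lebesgue_rV n _ * _)%E.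
by apply/seteqP; split=> v /=; rewrite mulmxA.
Qed.

Lemma lebesgue_rV_dyadic n k z :
  lebesgue_rV n (dyadic k @^-1` [set z]) = ((2^-1 ^+ k : R) ^+ n)%:E.
Proof.
rewrite dyadic_fiberE (lebesgue_rV_box (A := fun i =>
  `[(z ord0 i)%:~R / 2 ^+ k, (z ord0 i + 1)%:~R / 2 ^+ k[%classic)); last first.
  by move=> i; exact: measurable_itv.
under eq_bigr => i _.
  rewrite lebesgue_measure_itv/= lte_fin ltr_pM2r ?invr_gt0 ?exprn_gt0//.
  rewrite ltr_int ltrDl ltr01 -EFinB -mulrBl -intrB addrC addKr mul1r -exprVn.
  over.
by rewrite prodEFin prodr_const card_ord.
Qed.

(** The preimage of a cube is the box with permuted edges, of the same volume. Equality on Borel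
    sets follows from the cube comparison in both directions. *)
Lemma lebesgue_scaling_perm n (s : 'S_n) : lebesgue_scaling (perm_mx s : 'M[R]_n).
Proof.
move=> A mA; rewrite det_perm normrX normrN1 expr1n mule1.
have [m mE] := exists_pushforward (lebesgue_rV n) (measurable_mulmxr (perm_mx s)).
have fE k z : m (dyadic k @^-1` [set z]) = lebesgue_rV n (dyadic k @^-1` [set z]).
  rewrite mE /pushforward dyadic_fiberE; set I := fun i => _.
  rewrite [RHS](lebesgue_rV_box (A := fun i =>
    `[(z ord0 i)%:~R / 2 ^+ k, (z ord0 i + 1)%:~R / 2 ^+ k[%classic)); last first.
    by move=> i; exact: measurable_itv.
  rewrite (reindex_inj (@perm_inj _ s)) /=.
  rewrite -(lebesgue_rV_box (A := fun i => `[(z ord0 (s i))%:~R / 2 ^+ k,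
    (z ord0 (s i) + 1)%:~R / 2 ^+ k[%classic)); last first.
    by move=> i; exact: measurable_itv.
  congr (lebesgue_rV n _).
  have vE (v : 'rV[R]_n) i : (v *m perm_mx s) ord0 (s i) = v ord0 i.
    rewrite -[s in perm_mx s]invgK -col_permE mxE.
    by rewrite permK.
  apply/seteqP; split=> v /= vz i; first by rewrite -vE; exact: vz.
  by rewrite -(permKV s i) vE permKV; have := vz (s^-1 i)%g; rewrite permKV.
have fin z : (lebesgue_rV n (@dyadic R n 0 @^-1` [set z]) < +oo)%E.
  by rewrite lebesgue_rV_dyadic ltry.
transitivity (m A); first by rewrite mE.
apply/eqP; rewrite eq_le.
apply/andP; split; apply: dyadic_measure_le => //.
- by move=> k z; rewrite fE.
- by move=> k z; rewrite fE.
- by move=> z; rewrite fE.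
Qed.

(** Fubini: on the slice with fixed tail [w], the map acts on the first coordinate by the affine map
    of slope [l] and shift [w *m c], and shifts do not affect lengths. The remaining integral over
    [w] is transformed by [T]. *)
Lemma lebesgue_scaling_lblock n (l : R) (c : 'M[R]_(n, 1)) (T : 'M[R]_n) :
  l != 0 -> lebesgue_scaling T ->
  @lebesgue_scaling n.+1 (block_mx (l%:M : 'M[R]_1) 0 c T : 'M[R]_(1 + n)).
Proof.
move=> l0 scT A mA.
pose M : 'M[R]_n.+1 := (block_mx (l%:M : 'M[R]_1) 0 c T : 'M[R]_(1 + n)).
have mP : measurable (@cons_rV R n @^-1` A).
  by rewrite -[X in measurable X]setTI; apply: measurable_cons_rV.
have mAM : measurable ((fun v : 'rV[R]_n.+1 => v *m M) @^-1` A).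
  by rewrite -[X in measurable X]setTI; apply: measurable_mulmxr.
have mPM : measurable (@cons_rV R n @^-1` ((fun v : 'rV[R]_n.+1 => v *m M) @^-1` A)).
  by rewrite -[X in measurable X]setTI; apply: measurable_cons_rV.
have sliceE B : measurable (@cons_rV R n @^-1` B) -> lebesgue_rV n.+1 B =
    (\int[lebesgue_rV n]_w lebesgue_measure (ysection (@cons_rV R n @^-1` B) w))%E.
  move=> mB; have := indic_fubini_tonelli lebesgue_measure (lebesgue_rV n) mB.
  rewrite indic_fubini_tonelli_FE// indic_fubini_tonelli_GE//.
rewrite sliceE// [RHS]sliceE//.
pose G w := lebesgue_measure (ysection (@cons_rV R n @^-1` A) w).
have mG : measurable_fun setT G by exact: measurable_fun_ysection.
have consM a w : cons_rV (a, w) *m M = cons_rV (a * l + (w *m c) ord0 ord0, w *m T).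
  rewrite /cons_rV/= (@mul_row_block _ 1 1 n 1 n) mulmx0 add0r -scalar_mxM.
  by rewrite raddfD/= -mx11_scalar.
have slice w : (lebesgue_measure (ysection (@cons_rV R n @^-1`
    ((fun v : 'rV[R]_n.+1 => v *m M) @^-1` A)) w) * `|l|%:E = G (w *m T))%E.
  rewrite /G -[RHS](lebesgue_measure_affine ((w *m c) ord0 ord0) l0); last first.
    exact: measurable_ysection.
  congr (lebesgue_measure _ * _)%E; apply/seteqP; split=> a.
    by rewrite /= => /ysectionP /=; rewrite consM => ?; apply/ysectionP.
  by rewrite /= => /ysectionP /= ?; apply/ysectionP => /=; rewrite consM.
rewrite (@det_lblock _ 1 n) det_scalar1 normrM EFinM muleA.
rewrite -ge0_integralZr//; last first.
  exact: measurable_fun_ysection.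
under eq_integral do rewrite slice.
have [m mE] := exists_pushforward (lebesgue_rV n) (measurable_mulmxr T).
have -> : (\int[lebesgue_rV n]_w G (w *m T) = \int[m]_w G w)%E.
  by rewrite mE (ge0_integral_pushforward (measurable_mulmxr T)).
pose m' : {measure set 'rV[R]_n -> \bar R} := mscale (NngNum (normr_ge0 (\det T))) m.
transitivity (\int[m']_w G w)%E; first by rewrite ge0_integral_mscale// muleC.
apply: eq_measure_integral => B mB _.
by rewrite /m'/= /mscale/= mE muleC; exact: scT.
Qed.

Lemma lebesgue_scaling_lower n (T : 'M[R]_n) :
  is_trig_mx T -> \det T != 0 -> lebesgue_scaling T.
Proof.
elim: n T => [|n ih] T tT dT.
  move=> A mA; rewrite [T]flatmx0 det_mx00 normr1 mule1; congr (lebesgue_rV 0 _).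
  by apply/seteqP; split=> v /=; rewrite (_ : v *m _ = v)//; apply/rowP; case.
have T1 : T = block_mx ((T ord0 ord0)%:M : 'M[R]_1) 0
    (dlsubmx (T : 'M[R]_(1 + n))) (drsubmx (T : 'M[R]_(1 + n))) :> 'M[R]_(1 + n).
  rewrite -[LHS](@submxK _ 1 n 1 n); congr block_mx.
    by rewrite [LHS]mx11_scalar !mxE; congr (fun_of_matrix _ _ _)%:M; exact: val_inj.
  apply/matrixP => i j; rewrite !mxE; have /is_trig_mxP := tT; apply.
  by rewrite (ord1 i).
move: dT; rewrite T1 (@det_lblock _ 1 n) det_scalar1 mulf_eq0 negb_or.
move=> /andP[T00 dT'].
apply: lebesgue_scaling_lblock => //; apply: ih => //.
apply/is_trig_mxP => i j ij; rewrite !mxE.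
by have /is_trig_mxP := tT; apply.
Qed.

(** Conjugation by the permutation [s] that reverses the order of the coordinates turns an upper
    triangular matrix into a lower triangular one. *)
Lemma lebesgue_scaling_upper n (T : 'M[R]_n) :
  is_trig_mx T^T -> \det T != 0 -> lebesgue_scaling T.
Proof.
move=> /is_trig_mxP tT dT.
pose s : 'S_n := perm (can_inj (@rev_ordK n)).
have sV : (s * s = 1)%g by apply/permP => i; rewrite permM !permE rev_ordK.
have ss : perm_mx s *m perm_mx s = 1%:M :> 'M[R]_n by rewrite -perm_mxM sV perm_mx1.
have TE : T = perm_mx s *m ((perm_mx s *m T *m perm_mx s) *m perm_mx s).
  by rewrite !mulmxA ss mul1mx -mulmxA ss mulmx1.
rewrite TE; apply: lebesgue_scalingM; first exact: lebesgue_scaling_perm.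
apply: lebesgue_scalingM; last exact: lebesgue_scaling_perm.
apply: lebesgue_scaling_lower.
  apply/is_trig_mxP => i j ij.
  rewrite -row_permE -[s in perm_mx s]invgK -col_permE !mxE.
  have -> : (s^-1 = s)%g by apply/eqP; rewrite eq_invg_mul sV.
  have := tT (s j) (s i); rewrite mxE; apply.
  by rewrite !permE/=; have := ltn_ord i; have := ltn_ord j; move: ij; lia.
by rewrite !det_mulmx !mulf_neq0 ?det_perm ?signr_eq0.
Qed.

(** The LUP decomposition writes [T] as a permutation, a lower and an upper triangular matrix; none
    is singular since [\det T] is the product of their determinants. *)
Lemma lebesgue_scaling_det n (T : 'M[R]_n) : \det T != 0 -> lebesgue_scaling T.
Proof.
case: n T => [|n] T dT.
  by apply: lebesgue_scaling_lower => //; apply/is_trig_mxP; case.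
have := cormen_lup_correct T; have := cormen_lup_perm T.
have := @cormen_lup_lower _ _ T; have := @cormen_lup_upper _ _ T.
have := cormen_lup_detL T.
case: (cormen_lup T) => [[P L] U] /= dL Uu Ll /is_perm_mxP[s ->] PT.
have TE : T = perm_mx s^-1 *m (L *m U).
  by rewrite mulmxE -PT -mulmxE mulmxA -perm_mxM mulVg perm_mx1 mul1mx.
move: dT; rewrite TE !det_mulmx !mulf_eq0 !negb_or => /and3P[_ dL0 dU].
apply: lebesgue_scalingM; first exact: lebesgue_scaling_perm.
apply: lebesgue_scalingM.
  apply: lebesgue_scaling_lower => //; apply/is_trig_mxP => i j ij.
  by rewrite Ll ?(ltnW ij)//; case: eqP ij => // ->; rewrite ltnn.
apply: lebesgue_scaling_upper => //; apply/is_trig_mxP => i j ij.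
by rewrite mxE Uu.
Qed.

End linear_change.

(** * Lipschitz maps *)

Section sup_norm.
Context {R : realType} {n : nat}.
Implicit Types v : 'rV[R]_n.

Lemma entry_le_norm m (A : 'M[R]_(m, n)) i j : `|A i j| <= `|A|.
Proof.
rewrite [leRHS]/Num.Def.normr/= mx_normrE.
exact: (le_bigmax _ (fun ij : 'I_m * 'I_n => `|A ij.1 ij.2|) (i, j)).
Qed.

Lemma norm_le_coord v (d : R) : 0 <= d -> (forall i, `|v ord0 i| <= d) -> `|v| <= d.
Proof.
move=> d0 vd; rewrite [leLHS]/Num.Def.normr/= mx_normrE.
apply: bigmax_le => // -[i j] _ /=.
by rewrite (ord1 i).
Qed.

End sup_norm.

Section measurability.
Context {R : realType} {n : nat}.

Lemma measurable_fun_rV_within d (S : measurableType d) (D : set S)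
    (f : S -> 'rV[R]_n) : measurable D ->
  (forall i, measurable_fun D (fun s => f s ord0 i)) -> measurable_fun D f.
Proof.
move=> mD mf.
apply: (measurability (\big[setU/set0]_(i < n) preimage_set_system
  [set: 'rV[R]_n] (fun v => v ord0 i) measurable)) => //.
move=> _ [B + <-]; rewrite -bigcup_seq/= => -[i _ [C mC <-]].
by rewrite setTI; exact: mf.
Qed.

Lemma open_continuous_measurable (D : set 'rV[R]_n) (f : 'rV[R]_n -> R) :
  open D -> {in D, continuous f} -> measurable_fun D f.
Proof.
move=> oD cf; apply: (measurability _ (RGenOpens.measurableE R)).
move=> _ [_ [a [b ->] <-]]; apply: open_measurable_rV.
rewrite openE => x [Dx fx]; apply: filterI; first exact: open_nbhs_nbhs.
by apply: (cf x (mem_set Dx)); apply: open_nbhs_nbhs; split.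
Qed.

End measurability.

Lemma open_continuous_measurable_rV (R : realType) n p (D : set 'rV[R]_n)
    (f : 'rV[R]_n -> 'rV[R]_p) :
  open D -> {in D, continuous f} -> measurable_fun D f.
Proof.
move=> oD cf; apply: measurable_fun_rV_within; first exact: open_measurable_rV.
move=> i; apply: open_continuous_measurable => // x Dx.
apply: (@continuous_comp _ _ _ f (fun v : 'rV[R]_p => v ord0 i)); first exact: cf.
exact: coord_continuous.
Qed.

Section lipschitz.
Context {R : realType} {n : nat}.

(** The enclosing cube has the infima of the coordinates over [E] as its lower corner. *)
Lemma lebesgue_rV_le_diameter (E : set 'rV[R]_n) (d : R) : 0 <= d ->
  measurable E -> (forall y z, E y -> E z -> `|y - z| <= d) ->
  (lebesgue_rV n E <= (d ^+ n)%:E)%E.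
Proof.
move=> d0 mE Ed.
have [->|/set0P[y Ey]] := eqVneq E set0.
  by rewrite measure0 lee_fin exprn_ge0.
pose a i : R := inf [set z ord0 i | z in E].
have aE z i : E z -> a i <= z ord0 i <= a i + d.
  move=> Ez; have lb w : E w -> z ord0 i - d <= w ord0 i.
    move=> Ew; have := le_trans (entry_le_norm (z - w) ord0 i) (Ed _ _ Ez Ew).
    by rewrite !mxE => /(le_trans (ler_norm _)); lra.
  apply/andP; split.
    apply: ge_inf; last by exists z.
    by exists (z ord0 i - d) => _ [w Ew <-]; exact: lb.
  rewrite -lerBlDr; apply: lb_le_inf; first by exists (z ord0 i), z.
  by move=> _ [w Ew <-]; exact: lb.
pose B i := `[a i, a i + d]%classic.
have mB i : measurable (B i) by exact: measurable_itv.
apply: (@le_trans _ _ (lebesgue_rV n [set v : 'rV[R]_n | forall i, B i (v ord0 i)])).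
  apply: le_measure; rewrite ?inE//; first exact: measurable_box.
  by move=> z Ez i; rewrite /B/= in_itv/= aE.
rewrite lebesgue_rV_box//.
under eq_bigr => i _.
  rewrite lebesgue_measure_itv/= lte_fin ltrDl.
  (* The length formula gives 0 unless [0 < d]; for [d = 0] this is still [d]. *)
  rewrite (_ : (if _ then _ else _) = d%:E); last first.
    case: ltP => [_|d0']; first by rewrite -EFinD addrC addKr.
    by congr EFin; apply/eqP; rewrite eq_le d0.
  over.
by rewrite prodEFin prodr_const card_ord.
Qed.

(* Since the sup norm is used, a set of diameter [d] lies in a cube of side [d],
   so no dimensional constant is lost. *)
Lemma expanding_measure_le (A B : set 'rV[R]_n) (k : 'rV[R]_n -> 'rV[R]_n)
    (L : R) : 0 <= L -> measurable A -> measurable B -> measurable_fun B k ->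
  (forall y, B y -> A (k y)) ->
  (forall y z, B y -> B z -> `|y - z| <= L * `|k y - k z|) ->
  (lebesgue_rV n B <= (L ^+ n)%:E * lebesgue_rV n A)%E.
Proof.
move=> L0 mA mB mk kA kL.
(* The pushforward takes a total function. The default value of [k] off [B] is harmless because the
   measure is restricted to [B]. *)
have mk' : measurable_fun setT (k \_ B) by apply/(measurable_restrictT k mB).
have [m mE] := exists_pushforward (mrestr (lebesgue_rV n) mB) mk'.
have kE C : (k \_ B) @^-1` C `&` B = B `&` k @^-1` C.
  apply/seteqP; split=> y /=; rewrite /patch => -[].
    by move=> + By; rewrite mem_set.
  by move=> By Cy; rewrite mem_set.
have mC C : m C = lebesgue_rV n (B `&` k @^-1` C) by rewrite -kE mE.
pose m2 : {measure set 'rV[R]_n -> \bar R} :=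
  mscale (NngNum (exprn_ge0 n L0)) (lebesgue_rV n).
have -> : lebesgue_rV n B = m A.
  rewrite mC; congr (lebesgue_rV n _).
  by apply/seteqP; split=> [y By|y []//]; split => //; exact: kA.
rewrite -[leRHS]/(m2 A); apply: dyadic_measure_le => //.
(* The points of [B] that [k] sends into a cube of side [2^-j] are at distance at most [L * 2^-j]
   from each other. *)
- move=> j z; rewrite mC /m2/= /mscale/= lebesgue_rV_dyadic -EFinM -exprMn.
  apply: lebesgue_rV_le_diameter.
  + by rewrite mulr_ge0 ?exprn_ge0.
  + exact: (mk mB _ (measurable_dyadic_fiber _ _)).
  + move=> x y [Bx /= xz] [By /= yz]; apply: le_trans (kL _ _ Bx By) _.
    rewrite ler_wpM2l//; apply: norm_le_coord => [|i]; first by rewrite exprn_ge0.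
    by rewrite !mxE; apply: dyadic_dist; rewrite xz.
- by move=> z; rewrite /m2/= /mscale/= lebesgue_rV_dyadic -EFinM ltry.
Qed.

End lipschitz.

(** * Differentiable maps *)

Section strict_differentiability.
Context {R : realType} {n : nat}.

Lemma ballrVP (x y : 'rV[R]_n) (d : R) : ball x d y <-> `|x - y| < d.
Proof. by rewrite mx_norm_ball. Qed.

Lemma is_derive_line (f : 'rV[R]_n -> 'rV[R]_n) (z v : 'rV[R]_n) (t : R) i :
  differentiable f (z + t *: v) ->
  is_derive t 1 (fun s : R => f (z + s *: v) ord0 i) ((v *m 'J f (z + t *: v)) ord0 i).
Proof.
move=> df.
pose l (s : R) := z + s *: v.
have dl : is_diff t l (fun s : R => s *: v).
  rewrite /l; apply: is_diff_eq.
  by apply/funext => s /=; rewrite /= add0r.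
have dlt : differentiable l t by [].
have dfl : differentiable (f \o l) t by exact: differentiable_comp.
have fl1 : 'D_1 (f \o l) t = v *m 'J f (l t).
  rewrite (deriveE _ dfl) diff_comp//= -deriveEjacobian// deriveE//; congr ('d f _ _).
  by rewrite diff_val scale1r.
have dM : derivable (f \o l) t 1 by exact: diff_derivable.
apply: DeriveDef; first exact: ((derivable_mxP _ _ _).1 dM).
by rewrite -[RHS]/((v *m 'J f (l t)) ord0 i) -fl1 derive_mx// mxE.
Qed.


(** The mean value theorem is applied to each coordinate along the segment from [z] to [y]; the
    remaining derivative is small because ['J f] is continuous at [x]. The factor [S] is meant for
    the inverse of ['J f x], which makes [f] followed by [S] close to the identity. *)
Lemma strictly_differentiable (Omega : set 'rV[R]_n) (f : 'rV[R]_n -> 'rV[R]_n)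
    (S : 'M[R]_n) (x : 'rV[R]_n) (e : R) :
  open Omega -> C1_on Omega f -> Omega x -> 0 < e ->
  \forall d \near 0^'+, ball x d `<=` Omega /\
    forall y z, ball x d y -> ball x d z ->
      `|(f y - f z) *m S - (y - z) *m ('J f x *m S)| <= e * `|y - z|.
Proof.
move=> oO fC1 Ox e0.
(* [c i] bounds what right multiplication by [S] can do to coordinate [i]. [K] dominates all of
   them, and its summand 1 keeps it positive when [S] vanishes. *)
pose c i := \sum_(j < n) \sum_(l < n) `|S l i|.
have c0 i : 0 <= c i by do 2 apply: sumr_ge0 => ? _.
pose K := 1 + \sum_i c i.
have K0 : 0 < K by rewrite ltr_pwDl// sumr_ge0.
have cK i : c i <= K.
  rewrite /K (bigD1 i)//= addrCA lerDl addr_ge0// sumr_ge0// => j _.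
have eK0 : 0 < e / K by rewrite divr_gt0.
have nJ : \forall w \near x, `|'J f x - 'J f w| < e / K.
  by have [_ /cvgr_dist_lt] := fC1 x Ox; apply.
have nO : \forall w \near x, Omega w by exact: open_nbhs_nbhs.
have /nbhs_ballP[d0 /= d00 d0P] : \forall w \near x,
  `|'J f x - 'J f w| < e / K /\ Omega w by apply: filterI.
near=> d.
have dd0 : ball x d `<=` ball x d0 by apply: le_ball; near: d; exact: nbhs_right_le.
split=> [w /dd0/d0P[]//|y z xy xz].
apply: norm_le_coord => [|i]; first by rewrite mulr_ge0// ltW.
have [v vE] : exists v, v = y - z by exists (y - z).
rewrite -vE; pose a := (v *m ('J f x *m S)) ord0 i.
(* Coordinate [i] of [f (z + t *: v) *m S] minus its linear prediction [t * a]; the increment of [g]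
   over [[0, 1]] is the coordinate to be bounded. *)
pose g : R -> R := (\sum_(j < n) (S j i \*: (fun t : R => f (z + t *: v) ord0 j)))
  - (a \*: id).
have gE t : g t = (f (z + t *: v) *m S) ord0 i - t * a.
  rewrite /g fctE/= fct_sumE mxE mulrC; congr (_ - _).
  by apply: eq_bigr => j _; rewrite mulrC.
have seg (t : R) : 0 <= t <= 1 -> ball x d0 (z + t *: v).
  move=> /andP[t0 t1]; apply: dd0; apply/ballrVP.
  have -> : x - (z + t *: v) = (1 - t) *: (x - z) + t *: (x - y).
    by apply/rowP => j; rewrite vE !mxE; ring.
  move: xy xz => /ballrVP xy /ballrVP xz.
  rewrite (le_lt_trans (ler_normD _ _))// !normrZ ger0_norm ?subr_ge0// (ger0_norm t0).
  (* Strictness comes from the term in [x - y], which disappears at [t = 0]. *)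
  have [->|tn0] := eqVneq t 0; first by rewrite mul0r addr0 subr0 mul1r.
  have tp : 0 < t by rewrite lt_def tn0.
  have h1 : t * `|x - y| < t * d by rewrite ltr_pM2l.
  have h2 : (1 - t) * `|x - z| <= (1 - t) * d by rewrite ler_wpM2l ?subr_ge0// ltW.
  lra.
have dg (t : R) : 0 <= t <= 1 ->
    is_derive t 1 g ((v *m (('J f (z + t *: v) - 'J f x) *m S)) ord0 i).
  move=> /seg/d0P[_ Ow].
  have [fw _] := fC1 _ Ow.
  have -> : (v *m (('J f (z + t *: v) - 'J f x) *m S)) ord0 i =
      \sum_(j < n) S j i *: (v *m 'J f (z + t *: v)) ord0 j - a *: 1.
    rewrite /a; move: ('J f x) ('J f _) => A B.
    rewrite (_ : v *m ((B - A) *m S) = v *m B *m S - v *m (A *m S)); last first.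
      by rewrite mulmxBl mulmxBr mulmxA.
    rewrite mxE [X in _ + X]mxE [X in X - _]mxE; congr (_ - _).
      by apply: eq_bigr => j _; exact: mulrC.
    by rewrite [RHS]mulr1.
  apply: is_deriveB.
    apply: is_derive_sum => j; apply: is_deriveZ.
    exact: is_derive_line.
  by apply: is_deriveZ.
have gder : forall t : R, t \in `]0, 1[%R ->
    is_derive t 1 g ((v *m (('J f (z + t *: v) - 'J f x) *m S)) ord0 i).
  by move=> t; rewrite in_itv/= => /andP[t0 t1]; apply: dg; rewrite !ltW.
have gcont : {within `[0, 1]%classic, continuous g}.
  apply: derivable_within_continuous => t; rewrite in_itv/= => t01.
  by have [] := dg t t01.
have [t t01] := MVT_segment ler01 gder gcont.
rewrite subr0 mulr1 !gE scale0r scale1r addr0 mul0r subr0 mul1r.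
have -> : z + v = y by rewrite vE addrC subrK.
move=> gt.
have -> : ((f y - f z) *m S - v *m ('J f x *m S)) ord0 i =
    (v *m (('J f (z + t *: v) - 'J f x) *m S)) ord0 i.
  rewrite -gt /a mulmxBl; move: (f y *m S) (f z *m S) (v *m _) => A B C.
  by rewrite !mxE; ring.
move: t01; rewrite in_itv/= => /seg/d0P[Jw _].
have hJ : `|'J f (z + t *: v) - 'J f x| <= e / K by rewrite distrC; exact: ltW.
rewrite mxE; apply: (le_trans (ler_norm_sum _ _ _)).
apply: (@le_trans _ _ (\sum_(j < n) `|v| * (e / K * \sum_(l < n) `|S l i|))).
  apply: ler_sum => j _; rewrite normrM ler_pM//; first exact: entry_le_norm.
  rewrite mxE (le_trans (ler_norm_sum _ _ _))// mulr_sumr.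
  apply: ler_sum => l _; rewrite normrM ler_wpM2r//.
  exact: le_trans (entry_le_norm ('J f (z + t *: v) - 'J f x) j l) hJ.
rewrite -!mulr_sumr -/(c i) [leRHS]mulrC ler_wpM2l//.
by rewrite mulrAC ler_pdivrMr// ler_wpM2l// ltW.
Unshelve. all: by end_near. Qed.

(** The chain rule for [h \o f], which is the identity near [x], shows on each basis vector that
    ['J h (f x)] inverts ['J f x]. *)
Lemma det_jacobian_neq0 (f h : 'rV[R]_n -> 'rV[R]_n) (x : 'rV[R]_n) :
  differentiable f x -> differentiable h (f x) ->
  (\forall y \near x, h (f y) = y) -> \det ('J f x) != 0.
Proof.
move=> df dh hf.
have JJ : 'J f x *m 'J h (f x) = 1%:M.
  apply/row_matrixP => i; rewrite !rowE mulmx1 mulmxA; set v := delta_mx _ _.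
  have hfv : 'D_v (h \o f) x = v by rewrite (near_eq_derive _ (g := id)) ?derive_id.
  rewrite -(deriveEjacobian v df) (deriveE v df) -(deriveEjacobian _ dh).
  rewrite (deriveE _ dh) -[RHS]hfv (deriveE v (differentiable_comp df dh)).
  exact: (esym (congr1 (fun F => F v) (diff_comp df dh))).
by have [+ _] := mulmx1_unit JJ; rewrite unitmxE unitfE.
Qed.

End strict_differentiability.

(** * Measures with a density *)

Section density.
Import HBNNSimple.
Local Open Scope ereal_scope.
Context d (T : measurableType d) (R : realType).
Variable mu : {measure set T -> \bar R}.
Variable g : T -> R.
Hypothesis mg : measurable_fun setT g.
Let mgE D : measurable_fun D (fun x => (g x)%:E).
Proof. by apply/measurable_EFinP; exact: measurable_funTS. Qed.

Hypothesis g0 : forall x, (0 <= g x)%R.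

Lemma exists_density : exists nu : {measure set T -> \bar R},
  forall A, nu A = \int[mu]_(x in A) (g x)%:E.
Proof.
pose nu A := \int[mu]_(x in A) (g x)%:E.
have nu0 : nu set0 = 0 by rewrite /nu integral_set0.
have nu_ge0 A : 0 <= nu A by apply: integral_ge0 => x _; rewrite lee_fin.
have nuU : semi_sigma_additive nu.
  move=> F mF tF mUF; rewrite /nu ge0_integral_bigcup//; last first.
    by move=> x _; rewrite lee_fin.
  by apply: is_cvg_ereal_nneg_natsum => i _; exact: nu_ge0.
pose mixin := isMeasure.Build _ _ _ nu nu0 nu_ge0 nuU.
by exists (HB.pack_for {measure set T -> \bar R} nu mixin).
Qed.

Variable nu : {measure set T -> \bar R}.
Hypothesis nuE : forall A, measurable A -> nu A = \int[mu]_(x in A) (g x)%:E.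

Let integral_density_indic (D A : set T) : measurable D -> measurable A ->
  \int[nu]_(x in D) (\1_A x)%:E = \int[mu]_(x in D) ((\1_A x)%:E * (g x)%:E).
Proof.
move=> mD mA; rewrite integral_indic// nuE; last exact: measurableI.
rewrite setIC integral_mkcondr; apply: eq_integral => x _.
by rewrite muleC epatch_indic.
Qed.

Let integral_density_nnsfun (D : set T) (s : {nnsfun T >-> R}) : measurable D ->
  \int[nu]_(x in D) (s x)%:E = \int[mu]_(x in D) ((s x)%:E * (g x)%:E).
Proof.
move=> mD.
pose c r x := (r * \1_(s @^-1` [set r]) x)%:E : \bar R.
have sE x : (s x)%:E = \sum_(r \in range s) c r x.
  by rewrite /c fsumEFin// -fimfunE.
have c0 r x : 0 <= c r x by exact: nnfun_muleindic_ge0.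
have mc r : measurable_fun D (c r).
  by apply/measurable_EFinP; apply: measurable_funM => //; exact: measurable_indic.
under eq_integral do rewrite sE.
under [RHS]eq_integral do rewrite sE ge0_mule_fsuml//.
rewrite !ge0_integral_fsum//; last 2 first.
- by move=> r; exact: (emeasurable_funM (mc r)).
- by move=> r x _; rewrite mule_ge0// lee_fin.
apply: eq_fsbigr => r /[!inE] -[t _ <-].
under eq_integral do rewrite /c EFinM.
under [RHS]eq_integral do rewrite /c EFinM -muleA.
rewrite ge0_integralZl//; last 2 first.
- by apply/measurable_EFinP; exact: measurable_indic.
- by rewrite lee_fin.
rewrite ge0_integralZl//; last 3 first.
- apply: emeasurable_funM => //.
  by apply/measurable_EFinP; exact: measurable_indic.
- by move=> x _; rewrite mule_ge0// lee_fin.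
- by rewrite lee_fin.
by rewrite integral_density_indic.
Qed.

(** Linearity carries the identity from indicators to simple functions, and monotone convergence
    carries it to [f]. *)
Lemma ge0_integral_density (D : set T) (f : T -> \bar R) : measurable D ->
  measurable_fun D f -> (forall x, D x -> 0 <= f x) ->
  \int[nu]_(x in D) f x = \int[mu]_(x in D) (f x * (g x)%:E).
Proof.
move=> mD mf f0; pose s := nnsfun_approx mD mf.
have sf x : D x -> (s k x)%:E @[k --> \oo] --> f x.
  by move=> Dx; exact: cvg_nnsfun_approx.
have nds x k l : (k <= l)%N -> (s k x <= s l x)%R.
  by move=> kl; exact/lefP/nd_nnsfun_approx.
have ms k : measurable_fun D (fun x => (s k x)%:E).
  by apply/measurable_EFinP; exact: measurable_funTS.
transitivity (limn (fun k => \int[nu]_(x in D) (s k x)%:E)).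
  rewrite -monotone_convergence//.
  - by apply: eq_integral => x /[!inE] /sf /cvg_lim ->.
  - by move=> k x _; rewrite lee_fin.
  - by move=> x _ k l kl; rewrite lee_fin nds.
under eq_fun do rewrite integral_density_nnsfun//.
rewrite -monotone_convergence//.
- apply: eq_integral => x /[!inE] Dx; apply/cvg_lim => //.
  by apply: cvgeZr => //; exact: sf.
- by move=> k; exact: (emeasurable_funM (ms k)).
- by move=> k x _; rewrite mule_ge0// lee_fin.
- by move=> x _ k l kl; apply: lee_wpmul2r; rewrite lee_fin //; exact: nds.
Qed.

End density.

(** * Change of variables *)

Lemma continuous_det (R : realType) n :
  continuous (fun A : 'M[R]_n => \det A).
Proof.
apply: continuous_big => [|s _ A]; first exact: add_continuous.
apply: (@cvgM _ _ (nbhs A)); first exact: cvg_cst.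
move: A; apply: continuous_big => [|i _ A]; first exact: mul_continuous.
exact: coord_continuous.
Qed.

Section local_change_of_variables.
Context {R : realType} {n : nat}.
Variables (D Omega : set 'rV[R]_n) (f h : 'rV[R]_n -> 'rV[R]_n).
Hypotheses (oD : open D) (oO : open Omega).
Hypotheses (fC1 : C1_on Omega f) (hC1 : C1_on D h).
Hypothesis fD : forall x, Omega x -> D (f x).
Hypothesis fK : forall x, Omega x -> h (f x) = x.
Hypothesis hK : forall y, D y -> Omega (h y) /\ f (h y) = y.
Variables m1 m2 : {measure set 'rV[R]_n -> \bar R}.
Hypothesis m1E : forall A, measurable A ->
  m1 A = lebesgue_rV n (D `&` h @^-1` A).
Hypothesis m2E : forall A, measurable A -> A `<=` Omega ->
  (m2 A = \int[lebesgue_rV n]_(x in A) (`|\det ('J f x)|)%:E)%E.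

Lemma C1_measurable (U : set 'rV[R]_n) (g : 'rV[R]_n -> 'rV[R]_n) :
  open U -> C1_on U g -> measurable_fun U g.
Proof.
move=> oU gC1; apply: open_continuous_measurable_rV => // x /[!inE] Ux.
by apply: differentiable_continuous; have [] := gC1 x Ux.
Qed.

Lemma measurable_det_jacobian (U : set 'rV[R]_n) (g : 'rV[R]_n -> 'rV[R]_n) :
  open U -> C1_on U g -> measurable_fun U (fun x => `|\det ('J g x)|).
Proof.
move=> oU gC1; apply: measurableT_comp; first exact: normr_measurable.
apply: open_continuous_measurable => // x /[!inE] Ux.
apply: (@continuous_comp _ _ _ (jacobian g) (fun A : 'M[R]_n => \det A)).
  by have [] := gC1 x Ux.
exact: continuous_det.
Qed.

Lemma det_jacobian_diffeo (x : 'rV[R]_n) : Omega x -> \det ('J f x) != 0.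
Proof.
move=> Ox; apply: (det_jacobian_neq0 (h := h)).
- by have [] := fC1 Ox.
- by have [] := hC1 (fD Ox).
- by apply: filterS (open_nbhs_nbhs (conj oO Ox)) => y /fK.
Qed.

Lemma det_jacobian_near (x : 'rV[R]_n) (s : R) : Omega x -> 0 < s < 1 ->
  \forall w \near x, s * `|\det ('J f x)| <= `|\det ('J f w)| /\
    s * `|\det ('J f w)| <= `|\det ('J f x)|.
Proof.
move=> Ox /andP[s0 s1].
have T0 : 0 < `|\det ('J f x)| by rewrite normr_gt0 det_jacobian_diffeo.
have cdet : \det ('J f w) @[w --> x] --> \det ('J f x).
  apply: (@continuous_comp _ _ _ (jacobian f) (fun A : 'M[R]_n => \det A)).
    by have [] := fC1 Ox.
  exact: continuous_det.
have cJ : `|\det ('J f w)| @[w --> x] --> `|\det ('J f x)|.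
  exact: (cvg_norm cdet).
apply: filterI.
  have : s * `|\det ('J f x)| < `|\det ('J f x)| by rewrite gtr_pMl.
  by move=> /(cvgr_gt _ cJ); apply: filterS => w /ltW.
have : `|\det ('J f x)| < `|\det ('J f x)| / s by rewrite ltr_pdivlMr// gtr_pMr.
move=> /(cvgr_lt _ cJ); apply: filterS => w /ltW.
by rewrite ler_pdivlMr// mulrC.
Qed.

Lemma local_change (x : 'rV[R]_n) (s : R) : Omega x -> 0 < s < 1 ->
  exists k, forall B, measurable B ->
    B `<=` dyadic k @^-1` [set dyadic k x] ->
    ((s ^+ n.+1)%:E * m1 B <= m2 B)%E /\ ((s ^+ n.+1)%:E * m2 B <= m1 B)%E.
Proof.
move=> Ox s01; have /andP[s0 s1] := s01.
set T := 'J f x; pose S := invmx T; pose t := `|\det T|.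
have T0 : \det T != 0 by exact: det_jacobian_diffeo.
have uT : T \in unitmx by rewrite unitmxE unitfE.
have t0 : 0 < t by rewrite normr_gt0.
have d0 : 0 < 1 - s by rewrite subr_gt0.
(* The tolerance [1 - s] gives the constant [1 / s] in both directions. If [b] is an increment and
   [a] its image, then [|a - b| <= (1 - s) |b|] yields [s |b| <= |a|] and [|a| <= (2 - s) |b|],
   where [s (2 - s) <= 1]. *)
have [d [dp [dO dS]]] : exists d : R, 0 < d /\ ball x d `<=` Omega /\
    forall y z, ball x d y -> ball x d z ->
      `|(f y - f z) *m S - (y - z) *m ('J f x *m S)| <= (1 - s) * `|y - z|.
  have nd := strictly_differentiable S oO fC1 Ox d0.
  have [d [dp [dO dS]]] := filter_ex (filterI (nbhs_right_gt 0) nd).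
  by exists d.
have [k kW] : exists k, dyadic k @^-1` [set dyadic k x] `<=`
    [set w | ball x d w /\ (s * `|\det ('J f x)| <= `|\det ('J f w)| /\
       s * `|\det ('J f w)| <= `|\det ('J f x)|)].
  apply: nbhs_dyadic; apply: filterI; first exact: nbhsx_ballx.
  exact: det_jacobian_near.
exists k => B mB Bk.
have BO : B `<=` Omega by move=> y /Bk/kW[/dO].
have fS y z : B y -> B z -> `|(f y *m S - f z *m S) - (y - z)| <= (1 - s) * `|y - z|.
  move=> /Bk/kW[By _] /Bk/kW[Bz _]; have := dS _ _ By Bz.
  by rewrite -/T mulmxV// mulmx1 mulmxBl.
(* [B1] is the image of [B] under [f], and [B2] is the image of [B1] under multiplication by [S].
   The maps between [B] and [B2] are the ones close to the identity. *)
pose B1 := D `&` h @^-1` B.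
have mB1 : measurable B1.
  exact: (C1_measurable oD hC1 (open_measurable_rV oD) mB).
pose B2 := (fun v : 'rV[R]_n => v *m T) @^-1` B1.
have mB2 : measurable B2.
  by rewrite -[X in measurable X]setTI; apply: measurable_mulmxr.
have m1B : m1 B = (lebesgue_rV n B2 * t%:E)%E.
  by rewrite m1E// -(lebesgue_scaling_det T0).
have s1n : 0 < s ^+ n by rewrite exprn_gt0.
have le1 : ((s ^+ n)%:E * lebesgue_rV n B2 <= lebesgue_rV n B)%E.
  rewrite muleC -lee_pdivlMr// muleC -exprVn.
  apply: (@expanding_measure_le _ _ _ _ (fun v => h (v *m T))) => //.
  - by rewrite invr_ge0 ltW.
  - apply: (@measurable_comp _ _ _ _ _ _ D) => //.
    + exact: open_measurable_rV.
    + by move=> _ [v [Dv _] <-].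
    + exact: C1_measurable.
    + by apply: measurable_funTS; exact: measurable_mulmxr.
  - by move=> v [].
  - move=> v w [Dv Bv] [Dw Bw]; have := fS _ _ Bv Bw.
    have [_ ->] := hK Dv; have [_ ->] := hK Dw.
    rewrite !mulmxK// ler_pdivlMl//.
    set a := v - w; set b := h _ - h _ => ab.
    have a1 : `|a| <= `|b| + `|a - b| by rewrite -[X in `|X| <= _](subrKC b) ler_normD.
    have {}ab : `|a| <= (2 - s) * `|b| by lra.
    have h1 : s * `|a| <= s * ((2 - s) * `|b|) by rewrite ler_pM2l.
    (* This is [s * (2 - s) <= 1], multiplied by the norm of [b]. *)
    have h2 : 0 <= (1 - s) ^+ 2 * `|b| by rewrite mulr_ge0// sqr_ge0.
    by rewrite expr2 in h2; lra.
have le2 : ((s ^+ n)%:E * lebesgue_rV n B <= lebesgue_rV n B2)%E.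
  rewrite muleC -lee_pdivlMr// muleC -exprVn.
  apply: (@expanding_measure_le _ _ _ _ (fun y => f y *m S)) => //.
  - by rewrite invr_ge0 ltW.
  - apply: (measurableT_comp (measurable_mulmxr S)).
    apply: (measurable_funS _ BO); first exact: open_measurable_rV.
    exact: C1_measurable.
  - move=> y By; rewrite /B2 /= mulmxKV//; split; first exact/fD/BO.
    by rewrite /= fK//; exact: BO.
  - move=> y z By Bz; have := fS _ _ By Bz; rewrite ler_pdivlMl//.
    set a := _ *m S - _; set b := y - z => ab.
    have b1 : `|b| <= `|a| + `|a - b|.
      by rewrite -{1}(subKr a b); exact: ler_normB.
    lra.
have mJ : measurable_fun B (fun x => (`|\det ('J f x)|)%:E).
  apply/measurable_EFinP; apply: (measurable_funS _ BO).
    exact: open_measurable_rV.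
  exact: measurable_det_jacobian.
have J0 y : B y -> (0%:E <= (`|\det ('J f y)|)%:E)%E.
  by move=> _; rewrite lee_fin; exact: normr_ge0.
have I1 : ((s * t)%:E * lebesgue_rV n B <=
    \int[lebesgue_rV n]_(y in B) (`|\det ('J f y)|)%:E)%E.
  rewrite -(integral_cst _ mB); apply: (ge0_le_integral _ mB).
  - by move=> y _; rewrite lee_fin mulr_ge0// ltW.
  - exact: measurable_cst.
  - exact: mJ.
  - by move=> y /Bk/kW[_ [Jy _]]; rewrite lee_fin; exact: Jy.
have I2 : (s%:E * \int[lebesgue_rV n]_(y in B) (`|\det ('J f y)|)%:E <=
    t%:E * lebesgue_rV n B)%E.
  have s0E : (0 <= s%:E)%E by rewrite lee_fin ltW.
  rewrite -(integral_cst _ mB) -(ge0_integralZl _ mB mJ J0 s0E).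
  apply: (ge0_le_integral _ mB).
  - by move=> y By; apply: mule_ge0; [exact: s0E|exact: J0].
  - exact: measurable_funeM.
  - exact: measurable_cst.
  - by move=> y /Bk/kW[_ [_ Jy]]; rewrite -EFinM lee_fin; exact: Jy.
rewrite (m2E mB BO) m1B exprS EFinM; split.
  rewrite [(_ * t%:E)%E]muleC muleACA -EFinM; apply: le_trans I1.
  by apply: lee_wpmul2l => //; rewrite lee_fin mulr_ge0// ltW.
rewrite [(s%:E * _)%E]muleC -muleA.
apply: (@le_trans _ _ ((s ^+ n)%:E * (t%:E * lebesgue_rV n B))%E).
  by apply: lee_wpmul2l => //; rewrite lee_fin ltW.
rewrite muleCA [leRHS]muleC; apply: lee_wpmul2l => //.
by rewrite lee_fin ltW.
Qed.

End local_change_of_variables.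

(** Stands in for the limit of [s ^+ n] as [s] tends to 1. In the induction [r] is split into two
    factors [Num.sqrt r]: one is bounded by the new factor of the power, the other by the induction
    hypothesis. *)
Lemma exists_expr_ge (R : realType) (n : nat) (r : R) : 0 < r < 1 ->
  exists s, 0 < s < 1 /\ r <= s ^+ n.
Proof.
elim: n r => [|n ih] r /andP[r0 r1].
  by exists r; rewrite expr0 r0 r1 ltW.
have u0 : 0 < Num.sqrt r by rewrite sqrtr_gt0.
have u1 : Num.sqrt r < 1 by rewrite -sqrtr1 ltr_sqrt.
have [|s [/andP[s0 s1] us]] := ih (Num.sqrt r); first by rewrite u0.
exists (Num.max s (Num.sqrt r)); split; first by rewrite lt_max s0 gt_max s1.
apply: (@le_trans _ _ (Num.sqrt r * Num.sqrt r)).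
  by rewrite -expr2 sqr_sqrtr// ltW.
rewrite exprS; apply: ler_pM; rewrite ?sqrtr_ge0//.
  by rewrite le_max lexx orbT.
apply: le_trans us _; rewrite lerXn2r ?nnegrE ?le_max ?lexx ?(ltW s0)//.
Qed.

Section change_of_variables.
Context {R : realType} {n : nat}.
Variables (D Omega : set 'rV[R]_n) (f h : 'rV[R]_n -> 'rV[R]_n).
Hypotheses (oD : open D) (oO : open Omega).
Hypotheses (fC1 : C1_on Omega f) (hC1 : C1_on D h).
Hypothesis fD : forall x, Omega x -> D (f x).
Hypothesis fK : forall x, Omega x -> h (f x) = x.
Hypothesis hK : forall y, D y -> Omega (h y) /\ f (h y) = y.

Let mD : measurable D. Proof. exact: open_measurable_rV. Qed.
Let mO : measurable Omega. Proof. exact: open_measurable_rV. Qed.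

Lemma measure_change_of_variables (m1 m2 : {measure set 'rV[R]_n -> \bar R}) :
  (forall A, measurable A -> m1 A = lebesgue_rV n (D `&` h @^-1` A)) ->
  (forall A, measurable A -> A `<=` Omega ->
    (m2 A = \int[lebesgue_rV n]_(x in A) (`|\det ('J f x)|)%:E)%E) ->
  forall A, measurable A -> A `<=` Omega -> m1 A = m2 A.
Proof.
move=> m1E m2E A mA AO.
have loc (s : R) : 0 < s < 1 ->
    ((s ^+ n.+1)%:E * m1 A <= m2 A)%E /\ ((s ^+ n.+1)%:E * m2 A <= m1 A)%E.
  move=> s01; have /andP[s0 _] := s01; have sn0 := exprn_ge0 n.+1 (ltW s0).
  pose m1s : {measure set 'rV[R]_n -> \bar R} := mscale (NngNum sn0) m1.
  pose m2s : {measure set 'rV[R]_n -> \bar R} := mscale (NngNum sn0) m2.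
  have lc := @local_change R n D Omega f h oD oO fC1 hC1 fD fK hK m1 m2 m1E m2E.
  split; [rewrite -[leLHS]/(m1s A)|rewrite -[leLHS]/(m2s A)];
    apply: (local_measure_le (U := Omega)) => // x Ox;
    have [k kP] := lc x s Ox s01; exists k => B mB Bk;
    by have [] := kP B mB Bk.
(* An inequality holds as soon as it holds with every factor [r] of []0, 1[] on its left, and each
   such [r] lies below some [s ^+ n.+1]. *)
apply/eqP; rewrite eq_le; apply/andP; split;
    apply/lee_mul01Pr => // r r01; have [s [s01 rs]] := exists_expr_ge n.+1 r01;
    have [l1 l2] := loc s s01.
  by apply: le_trans l1; apply: lee_wpmul2r; rewrite ?lee_fin.
by apply: le_trans l2; apply: lee_wpmul2r; rewrite ?lee_fin.
Qed.

Lemma ge0_change_of_variables (F : 'rV[R]_n -> \bar R) :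
  measurable_fun D F -> (forall y, D y -> (0 <= F y)%E) ->
  (\int[lebesgue_rV n]_(y in D) F y =
   \int[lebesgue_rV n]_(x in Omega) (F (f x) * (`|\det ('J f x)|)%:E))%E.
Proof.
move=> mF F0.
pose h' := h \_ D.
have mh' : measurable_fun setT h'.
  by apply/(measurable_restrictT h mD); exact: C1_measurable.
pose mr : {measure set 'rV[R]_n -> \bar R} := mrestr (lebesgue_rV n) mD.
have h'E C : h' @^-1` C `&` D = D `&` h @^-1` C.
  apply/seteqP; split=> y /=; rewrite /h' /patch => -[].
    by move=> + Dy; rewrite mem_set.
  by move=> Dy Cy; rewrite mem_set.
have [m1 m1p] := exists_pushforward mr mh'.
have m1E A : measurable A -> m1 A = lebesgue_rV n (D `&` h @^-1` A).
  by move=> _; rewrite m1p -h'E.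
pose g := (fun x => `|\det ('J f x)|) \_ Omega.
have mg : measurable_fun setT g.
  apply/(measurable_restrictT (fun x => `|\det ('J f x)|) mO).
  exact: measurable_det_jacobian.
have g0 x : 0 <= g x by rewrite /g /patch; case: ifP => // _; exact: normr_ge0.
have gE x : Omega x -> g x = `|\det ('J f x)|.
  by move=> Ox; rewrite /g patchE mem_set.
have [m2 m2E] := exists_density (lebesgue_rV n) mg g0.
have m2J A : measurable A -> A `<=` Omega ->
    (m2 A = \int[lebesgue_rV n]_(x in A) (`|\det ('J f x)|)%:E)%E.
  move=> mA AO; rewrite m2E; apply: eq_integral => x /set_mem /AO Ox.
  by rewrite gE.
have mFf : measurable_fun Omega (F \o f).
  apply: (measurable_comp mD) => //; first by move=> _ [x Ox <-]; exact: fD.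
  exact: C1_measurable.
have Ff0 x : Omega x -> (0 <= (F \o f) x)%E by move=> /fD; exact: F0.
transitivity (\int[lebesgue_rV n]_(x in Omega) ((F \o f) x * (g x)%:E))%E; last first.
  by apply: eq_integral => x /set_mem Ox; rewrite gE.
rewrite -(ge0_integral_density mg g0 (fun A _ => m2E A) mO mFf Ff0).
transitivity (\int[m1]_(x in Omega) (F \o f) x)%E; last first.
  by apply: eq_measure_integral => A mA AO; exact: (measure_change_of_variables m1E m2J).
rewrite m1p (ge0_integral_pushforward mh')//; last by move=> x /set_mem; exact: Ff0.
have mP : measurable (h' @^-1` Omega) by rewrite -[X in measurable X]setTI; exact: mh'.
(* Off [D] the map [h'] has a default value that may lie in [Omega], so the preimage of [Omega] may
   be larger than [D]. The excess is null for [mr]. *)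
rewrite (ge0_negligible_integral (N := ~` D)) //; last first.
- by rewrite /= /mr /mrestr setICl measure0.
- by move=> x; exact: Ff0.
- apply: (measurable_comp mO) => //; last exact: measurable_funTS.
  by move=> _ [y Oy <-].
- exact: measurableC.
rewrite setDE setCK h'E.
have -> : D `&` h @^-1` Omega = D.
  by apply/seteqP; split=> [y []//|y Dy]; split => //; have [] := hK Dy.
transitivity (\int[mr]_(y in D) F y)%E.
  apply: eq_measure_integral => A mA AD.
  by rewrite /mr /= /mrestr setIidl.
apply: eq_integral => y /set_mem Dy /=.
by rewrite /h' patchE mem_set//; have [_ ->] := hK Dy.
Qed.

(** No integrability is assumed: the integral is by definition the difference of those of the
    positive and negative parts, and the nonnegative factor [|\det ('J f x)|] commutes with taking
    these parts. *)
Lemma change_of_variables (F : 'rV[R]_n -> R) : measurable_fun D F ->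
  (\int[lebesgue_rV n]_(y in D) (F y)%:E =
   \int[lebesgue_rV n]_(x in Omega) (F (f x) * `|\det ('J f x)|)%:E)%E.
Proof.
move=> mF.
have mFE : measurable_fun D (fun y => (F y)%:E) by exact/measurable_EFinP.
have maxM (a j : R) : 0 <= j -> (maxe a%:E 0 * j%:E = maxe (a * j)%:E 0)%E.
  by move=> j0; rewrite -!EFin_max -EFinM maxr_pMl// mul0r.
rewrite integralE [RHS]integralE; congr (_ - _)%E.
  rewrite (ge0_change_of_variables (measurable_funepos mFE)); last first.
    by move=> y _; exact: funepos_ge0.
  by apply: eq_integral => x _; rewrite !funeposE maxM ?normr_ge0.
rewrite (ge0_change_of_variables (measurable_funeneg mFE)); last first.
  by move=> y _; exact: funeneg_ge0.
by apply: eq_integral => x _; rewrite !funenegE -!EFinN maxM ?normr_ge0// mulNr.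
Qed.

End change_of_variables.

Unset Implicit Arguments.

Theorem theorem1p1 (R : realType) (m : nat) (m_ge1 : (1 <= m)%N)
    (D Omega : set 'rV[R]_m) (phi : 'rV[R]_m -> 'rV[R]_m) (f : 'rV[R]_m -> R)
    (D_dom : bounded_domain D) (Omega_dom : bounded_domain Omega)
    (D_bdry : piecewise_C1_boundary D)
    (Omega_bdry : piecewise_C1_boundary Omega)
    (phi_C1 : C1_closure Omega phi)
    (phi_diffeo : C1_diffeomorphism Omega D phi)
    (f_cont : {within closure D, continuous f}) :
  (\int[lebesgue_rV m]_(y in D) (f y)%:E =
   \int[lebesgue_rV m]_(x in Omega) (f (phi x) * `|\det ('J phi x)|)%:E)%E.
Proof.
have [_ oD _ _] := D_dom; have [_ oO _ _] := Omega_dom.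
have [[phiD _ phiS] phiC1 [h [hphi hC1]]] := phi_diffeo.
apply: (change_of_variables oD oO phiC1 hC1 phiD hphi).
(* [h] is given as a left inverse on [Omega]; surjectivity of [phi] onto [D] makes it a right
   inverse as well. *)
- by move=> _ /phiS[x Ox <-]; rewrite hphi.
- apply: open_continuous_measurable => //.
  rewrite -continuous_open_subspace//.
  by apply: continuous_subspaceW f_cont; exact: subset_closure.
Qed.
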